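(* Let $\gamma\in\{0,1,\dots,n-2\}$, $\varepsilon\in(0,1)$, and let $G^{(0)}$ be an initial graph on $n$ vertices. Consider any sequence of edge insertions that yields a final graph $G$. If $G$ is locally $\gamma$-sparse, then $\textsc{Lazy-Alg}\!\left(\varphi=\frac{\varepsilon}{1-\varepsilon},\,k=0\right)$ has approximation ratio $\frac{\gamma+1}{1-\varepsilon}$ (i.e., at every time step, for every vertex $v$, $\widetilde{\mathcal{B}}_2(v)\subseteq\mathcal{B}_2(v)$ and $|\widetilde{\mathcal{B}}_2(v)|\ge\frac{1-\varepsilon}{\gamma+1}|\mathcal{B}_2(v)|$) and amortized update cost $O(1/\varepsilon)$ per edge insertion.
   Context: For a vertex $x$ of a graph: $N(x)$ is its neighborhood, $\deg_x=|N(x)|$, $L_1(x)=N(x)$, $L_2(x)$ the set of vertices at distance exactly $2$ from $x$, $\mathcal{B}_1(x)=N(x)\cup\{x\}$, $\mathcal{B}_2(x)$ the set of vertices at distance at most $2$ from $x$. For $V'\subseteq V$, $G[V']$ is the induced subgraph. Locally $\gamma$-sparse: a graph $G=(V,E)$ on $n$ vertices is locally $\gamma$-sparse if for each vertex $u\in V$: (i) every $v\in L_1(u)$ has degree at most $\gamma$ in $G[L_1(u)]$, and (ii) every $w\in L_2(u)$ has degree at most $\gamma+1$ in $G[L_1(u)\cup\{w\}]$. Algorithm $\textsc{Lazy-Alg}(\varphi,k)$: each vertex $x$ stores sets $\widetilde{\mathcal{B}}_1(x)$, $\widetilde{\mathcal{B}}_2(x)$ and counters $\delta_x,\Delta_x$,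 initialized on $G^{(0)}$ as $\delta_x=0$, $\Delta_x=\deg_x$, $\widetilde{\mathcal{B}}_1(x)=\mathcal{B}_1(x)$, $\widetilde{\mathcal{B}}_2(x)=\mathcal{B}_2(x)$. On insertion of $(u,v)$ (added to the graph), for $x=u$ then $x=v$, with $y$ the other endpoint: (1) $\widetilde{\mathcal{B}}_1(x)\gets\widetilde{\mathcal{B}}_1(x)\cup\{y\}$; (2) $\widetilde{\mathcal{B}}_2(x)\gets\widetilde{\mathcal{B}}_2(x)\cup\widetilde{\mathcal{B}}_1(y)$; (3) $\delta_x\gets\delta_x+1$; (4) if $\delta_x\ge\varphi\Delta_x$, set $\Delta_x\gets\Delta_x+\delta_x$, $\delta_x\gets0$ and for each $z\in N(x)$ do $\widetilde{\mathcal{B}}_2(z)\gets\widetilde{\mathcal{B}}_2(z)\cup\widetilde{\mathcal{B}}_1(x)$; otherwise choose $k$ vertices $w_1,\dots,w_k\in N(x)$ uniformly at random and do $\widetilde{\mathcal{B}}_2(w_i)\gets\widetilde{\mathcal{B}}_2(w_i)\cup\widetilde{\mathcal{B}}_1(x)$ (with $k=0$ nothing is done in this branch). Cost: $T(S)$ is the number of set-union operations in steps (1), (2), (4) on sequence $S$; amortized cost $\hat c$ means $T(S)\le\hat c|S|$. *)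

(* Defs.v *)
From mathcomp Require Import all_boot all_order all_algebra.
From mathcomp Require Import reals.

Set Implicit Arguments.
Unset Strict Implicit.
Unset Printing Implicit Defensive.

Import Order.TTheory GRing.Theory Num.Theory.

Section Graphs.
Variable T : finType.
Implicit Types (e : rel T) (A : {set T}) (u v w x y : T).

Definition simple_graph e := symmetric e /\ irreflexive e.

Definition nbh e x : {set T} := [set y | e x y].

Definition deg e x : nat := #|nbh e x|.

(* The graph distance from x to y is at most r: some walk from x to y has at
   most r edges. *)
Definition dist_le e (r : nat) x y : bool :=
  [exists m : 'I_r.+1, [exists p : m.-tuple T, path e x p && (last x p == y)]].

Definition L1 e x : {set T} := nbh e x.

Definition L2 e x : {set T} := [set y | dist_le e 2 x y && ~~ dist_le e 1 x y].

Definition ball1 e x : {set T} := x |: nbh e x.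

Definition ball2 e x : {set T} := [set y | dist_le e 2 x y].

Definition induced e A : rel T := [rel a b | [&& a \in A, b \in A & e a b]].

Definition locally_sparse (gamma : nat) e : Prop :=
  forall u,
    (forall v, v \in L1 e u -> deg (induced e (L1 e u)) v <= gamma) /\
    (forall w, w \in L2 e u -> deg (induced e (w |: L1 e u)) w <= gamma.+1).

Definition add_edge e u v : rel T :=
  [rel x y | [|| e x y, (x == u) && (y == v) | (x == v) && (y == u)]].

Definition insert_edges e (S : seq (T * T)) : rel T :=
  foldl (fun e' p => add_edge e' p.1 p.2) e S.

(* Each insertion adds a new edge between two distinct vertices, so that all
   the intermediate graphs are simple. *)
Fixpoint valid_insertions e (S : seq (T * T)) : bool :=
  if S is (u, v) :: S' then
    [&& u != v, ~~ e u v & valid_insertions (add_edge e u v) S']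
  else true.

End Graphs.

Section LazyAlg.
Variables (R : realType) (T : finType).

(* sunions counts the set-union operations performed so far. *)
Record state := State {
  sgraph : rel T;
  sB1 : T -> {set T};
  sB2 : T -> {set T};
  sdelta : T -> nat;
  sDelta : T -> nat;
  sunions : nat
}.

Definition upd (A : Type) (f : T -> A) (x : T) (a : A) : T -> A :=
  fun z => if z == x then a else f z.

Definition lazy_init (e : rel T) : state :=
  State e (ball1 e) (ball2 e) (fun=> 0) (deg e) 0.

(* Processing of the endpoint x of a new edge xy already in the graph.  ws is
   the outcome of the draw of k neighbors of x, used only when the test against
   phi fails. *)
Definition lazy_endpoint (phi : R) (k : nat) (ws : k.-tuple T) (x y : T)
    (s : state) : state :=
  let G := sgraph s in
  let B1 := upd (sB1 s) x (y |: sB1 s x) in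
  let B2 := upd (sB2 s) x (sB2 s x :|: B1 y) in
  let d := (sdelta s x).+1 in
  let c := sunions s + 2 in
  if (phi * (sDelta s x)%:R <= d%:R)%R then
    State G B1
      (fun z => if z \in nbh G x then B2 z :|: B1 x else B2 z)
      (upd (sdelta s) x 0) (upd (sDelta s) x (sDelta s x + d))
      (c + #|nbh G x|)
  else
    State G B1
      (fun z => if z \in ws then B2 z :|: B1 x else B2 z)
      (upd (sdelta s) x d) (sDelta s)
      (c + k).

Definition lazy_insert (phi : R) (k : nat) (ws : T -> k.-tuple T) (u v : T)
    (s : state) : state :=
  let s0 := State (add_edge (sgraph s) u v) (sB1 s) (sB2 s)
                  (sdelta s) (sDelta s) (sunions s) in
  lazy_endpoint phi (ws v) v u (lazy_endpoint phi (ws u) u v s0).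

Fixpoint lazy_run (phi : R) (k : nat) (ws : nat -> T -> k.-tuple T) (i : nat)
    (s : state) (S : seq (T * T)) : state :=
  if S is (u, v) :: S' then
    lazy_run phi ws i.+1 (lazy_insert phi (ws i) u v s) S'
  else s.

(* ws i x is the k-sample of N(x) drawn for the endpoint x of the i-th inserted
   edge; the algorithm is a deterministic function of these draws.  When k = 0
   every draw is the empty tuple and there is no randomness. *)
Definition lazy_alg (phi : R) (k : nat) (ws : nat -> T -> k.-tuple T)
    (e0 : rel T) (S : seq (T * T)) : state :=
  lazy_run phi ws 0 (lazy_init e0) S.

End LazyAlg.

(* Main.v *)
Require Import Defs.
From mathcomp Require Import all_boot all_order all_algebra.
From mathcomp Require Import reals.
From mathcomp Require Import lra zify.

Set Implicit Arguments.
Unset Strict Implicit.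
Unset Printing Implicit Defensive.

(** Approximation.  If [x] is a neighbor of [v], the only vertices of [ball1 x]
    that may be missing from the approximate 2-ball of [v] are those joined to
    [x] since the last propagation from [x], or since the edge [vx] appeared.
    There are at most [delta_x <= phi * Delta_x] of them, that is at most
    [eps * deg x] since [deg x = Delta_x + delta_x].  Count the pairs [(x, w)]
    with [x] in [N(v)] and [w] in [ball1 x] distinct from [v]: each [x] is in
    exactly [deg x] pairs, and by sparsity each [w] of the 2-ball of [v] is in at
    least one and at most [gamma + 1] pairs.  Hence finding a fraction
    [1 - eps] of the pairs means finding a fraction [(1 - eps) / (gamma + 1)]
    of the 2-ball.

    Cost.  A propagation from [x] costs
    [deg x = Delta_x + delta_x <= delta_x / eps] and resets [delta_x], so that
    [\sum_x delta_x / eps] is a potential function. *)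

Import Order.TTheory GRing.Theory Num.Theory.
Local Open Scope ring_scope.

Section Graphs.
Variable T : finType.
Implicit Types (e : rel T) (u v w x y : T) (S : seq (T * T)).

(** * Balls of radius one and two *)

Lemma dist_leS e r x y :
  dist_le e r.+1 x y = (x == y) || [exists z, e x z && dist_le e r z y].
Proof.
apply/existsP/orP => [[[m lt_m] /existsP[p /andP[]]]|].
  case: m lt_m p => [|m] lt_m p.
    by rewrite (tuple0 p) /= => _ xy; left.
  case/tupleP: p => z p /= /andP[xz zp] zy; right.
  apply/existsP; exists z; rewrite xz /=.
  apply/existsP; exists (Ordinal (lt_m : (m < r.+1)%N)).
  by apply/existsP; exists p; rewrite zp.
case=> [/eqP->|/existsP[z /andP[xz /existsP[m /existsP[p zp]]]]].
  by exists ord0; apply/existsP; exists [tuple]; rewrite /= eqxx.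
exists (lift ord0 m); apply/existsP; exists (cons_tuple z p).
by rewrite /= xz.
Qed.

Lemma dist_le0 e x y : dist_le e 0 x y = (x == y).
Proof.
apply/existsP/eqP => [[[[|m] lt_m] // /existsP[p /andP[]]]|->].
  by rewrite (tuple0 p) => _ /eqP.
by exists ord0; apply/existsP; exists [tuple]; rewrite /= eqxx.
Qed.

Lemma dist_le1 e x y : dist_le e 1 x y = (x == y) || e x y.
Proof.
rewrite dist_leS; congr (_ || _); apply/existsP/idP => [[z]|xy].
  by rewrite dist_le0 => /andP[xz /eqP<-].
by exists y; rewrite xy dist_le0 eqxx.
Qed.

Lemma in_ball1 e x y : (y \in ball1 e x) = (y == x) || e x y.
Proof. by rewrite !inE. Qed.

Lemma in_ball2 e x y :
  (y \in ball2 e x) = (y == x) || [exists z, e x z && (y \in ball1 e z)].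
Proof.
rewrite inE dist_leS eq_sym; congr (_ || _); apply: eq_existsb => z.
by rewrite dist_le1 in_ball1 [z == y]eq_sym.
Qed.

Lemma ball2_nbh e x y z : e x z -> y \in ball1 e z -> y \in ball2 e x.
Proof.
by move=> xz zy; rewrite in_ball2; apply/orP; right; apply/existsP; exists z;
  rewrite xz.
Qed.

Lemma ball1_sub_ball2 e x : ball1 e x \subset ball2 e x.
Proof.
apply/subsetP => y; rewrite in_ball1 => /orP[/eqP->|xy].
  by rewrite in_ball2 eqxx.
by apply: ball2_nbh xy _; rewrite in_ball1 eqxx.
Qed.

Lemma card_ball1 e x : irreflexive e -> #|ball1 e x| = (deg e x).+1.
Proof. by move=> eI; rewrite /ball1 cardsU1 inE eI. Qed.

(** * Effect of edge insertions on the graph *)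

Lemma add_edge_simple e u v :
  u != v -> simple_graph e -> simple_graph (add_edge e u v).
Proof.
move=> uv [eS eI]; split=> [x y|x]; rewrite /add_edge /=.
  by rewrite eS; congr (_ || _); rewrite orbC ![(y == _) && _]andbC.
rewrite eI /=; apply/negP => /orP[] /andP[/eqP-> /eqP E].
  by rewrite E eqxx in uv.
by rewrite E eqxx in uv.
Qed.

Lemma ball1_add_edge e u v x :
  ball1 (add_edge e u v) x =
  (if x == u then [set v] else set0) :|: (if x == v then [set u] else set0)
    :|: ball1 e x.
Proof.
apply/setP => z; rewrite !inE /add_edge /=.
by case: (x == u); case: (x == v); rewrite !inE; case: (z == x); case: (e x z);
  case: (z == u); case: (z == v).
Qed.

Lemma sub_insert_edges e S : subrel e (insert_edges e S).
Proof.
elim: S e => [|[u v] S IH] e x y //= exy.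
by apply: IH; rewrite /add_edge /= exy.
Qed.

Lemma sub_insert_take e S t :
  subrel (insert_edges e (take t S)) (insert_edges e S).
Proof.
move=> x y exy; rewrite -[S in insert_edges e S](cat_take_drop t).
by rewrite /insert_edges foldl_cat; apply: sub_insert_edges.
Qed.

Lemma valid_take e S t : valid_insertions e S -> valid_insertions e (take t S).
Proof.
elim: S e t => [|[u v] S IH] e [|t] //= /and3P[-> -> /IH-> //].
Qed.

(** * Sparsity and double counting *)

Lemma locally_sparse_card gamma e v w : symmetric e -> w != v ->
  locally_sparse gamma e -> (#|nbh e v :&: ball1 e w| <= gamma.+1)%N.
Proof.
move=> eS wv /(_ v)[sp1 sp2]; have [vw|vw] := boolP (e v w).
  have /sp1 le_g : w \in L1 e v by rewrite inE.
  (* The extra one is [w] itself, which lies both in [N(v)] and in [ball1 e w]; the rest are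
     neighbors of [w] inside [L1 e v]. *)
  apply: leq_trans (_ : (1 + deg (induced e (L1 e v)) w <= _)%N) => //.
  rewrite -(cards1 w); apply: leq_trans (leq_card_setU _ _).
  apply: subset_leq_card; apply/subsetP => x; rewrite !inE /induced /= !inE vw.
  by case/andP=> -> /orP[->|->]; rewrite ?orbT.
(* A common neighbor puts [w] at distance exactly two from [v]. Since [w] is not in [N(v)], it does
   not count itself, and its degree bound [gamma + 1] suffices. *)
have [->|[x]] := set_0Vmem (nbh e v :&: ball1 e w); first by rewrite cards0.
rewrite !inE => /andP[vx wx].
have /sp2 le_g : w \in L2 e v.
  have := ball2_nbh (y := w) vx; rewrite in_ball1 eq_sym -eS wx inE => /(_ isT).
  by move=> vw2; rewrite inE vw2 dist_le1 negb_or eq_sym wv vw.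
apply: leq_trans le_g; apply: subset_leq_card; apply/subsetP => z.
rewrite !inE /induced /= !inE eqxx /= => /andP[vz /orP[/eqP zw|wz]].
  by rewrite -zw vz in vw.
by rewrite vz wz orbT.
Qed.

(** Transfers the multiplicity bound from the final graph, the only one assumed sparse, to all
    earlier graphs. *)
Lemma card_common_mono e e' v w : subrel e e' ->
  (#|nbh e v :&: ball1 e w| <= #|nbh e' v :&: ball1 e' w|)%N.
Proof.
move=> sub; apply: subset_leq_card; apply/subsetP => x; rewrite !inE.
by case/andP=> /sub-> /orP[->|/sub->]; rewrite ?orbT.
Qed.

Lemma ball2_common e v w : symmetric e -> w \in ball2 e v -> w != v ->
  (0 < #|nbh e v :&: ball1 e w|)%N.
Proof.
rewrite in_ball2 => eS /orP[->//|/existsP[x /andP[vx xw]]] _.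
apply/card_gt0P; exists x; rewrite !inE vx /= eq_sym eS.
by rewrite in_ball1 in xw.
Qed.

(* Removing [v] from [ball1 e x] leaves [deg e x] vertices; counting [x] itself
   in place of [v] is what makes the multiplicity of [w] at most [gamma + 1] for
   the neighbors of [v] as well. *)
Lemma sum_common e v (A : {set T}) : symmetric e ->
  (\sum_(x in nbh e v) #|A :&: (ball1 e x :\ v)| =
   \sum_(w in A :\ v) #|nbh e v :&: ball1 e w|)%N.
Proof.
move=> eS.
under eq_bigr => x _.
  rewrite -sum1_card; under eq_bigl => w do rewrite !inE.
  over.
under [RHS]eq_bigr => w _.
  rewrite -sum1_card; under eq_bigl => x do rewrite !inE.
  over.
rewrite (exchange_big_dep (fun w => w \in A :\ v)) /=; last first.
  by move=> x w _; rewrite !inE => /and3P[-> ->].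
apply: eq_bigr => w; rewrite !inE => /andP[-> ->]; apply: eq_bigl => x.
by rewrite inE [w == x]eq_sym [e w x]eS.
Qed.

Lemma ball2_approx (R : realType) (eps : R) gamma e v (A : {set T}) :
    simple_graph e -> 0 <= eps <= 1 ->
    v \in A -> A \subset ball2 e v ->
    (forall w, w != v -> (#|nbh e v :&: ball1 e w| <= gamma.+1)%N) ->
    (forall x, e v x -> #|ball1 e x :\: A|%:R <= eps * (deg e x)%:R) ->
  (1 - eps) / gamma.+1%:R * #|ball2 e v|%:R <= #|A|%:R.
Proof.
move=> [eS eI] /andP[eps0 eps1] vA subA sparse miss.
have g0 : 0 < gamma.+1%:R :> R by rewrite ltr0n.
have vB : v \in ball2 e v by rewrite in_ball2 eqxx.
have card_D1 x : e v x -> #|ball1 e x :\ v| = deg e x.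
  move=> vx; have := cardsD1 v (ball1 e x).
  by rewrite card_ball1 // in_ball1 eS vx orbT => -[].
have found x : e v x ->
    (1 - eps) * (deg e x)%:R <= #|A :&: (ball1 e x :\ v)|%:R :> R.
  move=> vx; have := miss x vx; rewrite -(card_D1 x vx).
  have -> : ball1 e x :\: A = (ball1 e x :\ v) :\: A.
    by apply/setP => z; rewrite !inE; case: (eqVneq z v) => // ->; rewrite vA.
  rewrite -[in X in _ -> X](cardsID A (ball1 e x :\ v)).
  rewrite -[in X in X -> _](cardsID A (ball1 e x :\ v)) setIC natrD.
  lra.
have upper : (\sum_(x in nbh e v) #|A :&: (ball1 e x :\ v)|
              <= gamma.+1 * #|A :\ v|)%N.
  rewrite sum_common // mulnC -sum_nat_const; apply: leq_sum => w.
  by rewrite !inE => /andP[/sparse].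
have lower : (#|ball2 e v :\ v| <= \sum_(x in nbh e v) deg e x)%N.
  rewrite -sum1_card.
  (* The same double count, with the full 2-ball in place of [A]. *)
  apply: (@leq_trans (\sum_(x in nbh e v) #|ball2 e v :&: (ball1 e x :\ v)|)).
    rewrite sum_common //; apply: leq_sum => w.
    by move=> /setD1P[wv wB]; apply: ball2_common.
  apply: leq_sum => x; rewrite inE => vx.
  by rewrite -(card_D1 x vx); apply: subset_leq_card; apply: subsetIr.
have pairs : (1 - eps) * (\sum_(x in nbh e v) deg e x)%:R
    <= (\sum_(x in nbh e v) #|A :&: (ball1 e x :\ v)|)%:R :> R.
  rewrite !natr_sum mulr_sumr; apply: ler_sum => x; rewrite inE; exact: found.
have {lower} lower : (1 - eps) * #|ball2 e v :\ v|%:R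
    <= (1 - eps) * (\sum_(x in nbh e v) deg e x)%:R.
  by apply: ler_wpM2l; rewrite ?subr_ge0 ?ler_nat.
move: upper; rewrite -(ler_nat R) natrM => upper.
(* The pairs leave out [v], which lies in both sets; its contribution is settled by
   [1 - eps <= 1 <= gamma + 1]. *)
rewrite mulrAC ler_pdivrMr // (cardsD1 v A) (cardsD1 v (ball2 e v)) vA vB.
rewrite !natrD /=.
have : 1 <= gamma.+1%:R :> R by rewrite ler1n.
move: upper pairs lower; lra.
Qed.

End Graphs.

(** * The invariant and its preservation at one endpoint *)

Section LazyAlg.
Variables (R : realType) (T : finType) (eps : R).
Let phi := eps / (1 - eps).
Implicit Types (s : state T) (x y z : T).

(* [k] counts the processed endpoints.  The invariant also holds between the two
   endpoints of an insertion, when one of them does not know the new edge yet: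
   hence the one-sided condition [x \in sB1 s a] in [inv_miss]. *)
Record lazy_inv (k : nat) s : Prop := LazyInv {
  inv_simple : simple_graph (sgraph s);
  inv_self : forall x, x \in sB1 s x;
  inv_B1 : forall x, sB1 s x \subset ball1 (sgraph s) x;
  inv_B12 : forall x, sB1 s x \subset sB2 s x;
  inv_B2 : forall x, sB2 s x \subset ball2 (sgraph s) x;
  inv_miss : forall a x, x \in sB1 s a ->
    (#|sB1 s x :\: sB2 s a| <= sdelta s x)%N;
  inv_card : forall x, #|sB1 s x| = (sDelta s x + sdelta s x).+1;
  inv_delta : forall x, (sdelta s x)%:R <= phi * (sDelta s x)%:R;
  inv_cost : (sunions s)%:R + (\sum_x sdelta s x)%:R / eps
             <= k%:R * (2 + eps^-1)
}.

Lemma sgraph_endpoint k (ws : k.-tuple T) x y s :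
  sgraph (lazy_endpoint phi ws x y s) = sgraph s.
Proof. by rewrite /lazy_endpoint; case: ifP. Qed.

Lemma sB1_endpoint k (ws : k.-tuple T) x y s :
  sB1 (lazy_endpoint phi ws x y s) = upd (sB1 s) x (y |: sB1 s x).
Proof. by rewrite /lazy_endpoint; case: ifP. Qed.


(** Only [x] has to be up to date except for [y]; nothing similar is asked of [y], so the lemma
    serves both endpoints of an insertion in turn. *)
Lemma lazy_endpoint_inv k (ws : 0.-tuple T) x y s : 0 < eps < 1 ->
    lazy_inv k s -> y \notin sB1 s x ->
    y |: sB1 s x = ball1 (sgraph s) x ->
  lazy_inv k.+1 (lazy_endpoint phi ws x y s).
Proof.
move=> /andP[eps0 eps1] [[gS gI] self B1s B12 B2s miss card dlt cost] yx ball_x.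
have phi0 : 0 < phi by rewrite divr_gt0 ?subr_gt0.
have xy : x != y by apply: contraNneq yx => <-.
have gxy : sgraph s x y.
  have := setU11 y (sB1 s x); rewrite ball_x in_ball1 => /orP[/eqP yx'|//].
  by rewrite yx' eqxx in xy.
pose B1 := upd (sB1 s) x (y |: sB1 s x).
pose B2 := upd (sB2 s) x (sB2 s x :|: B1 y).
have B1x : B1 x = ball1 (sgraph s) x by rewrite /B1 /upd eqxx.
have B1y : B1 y = sB1 s y by rewrite /B1 /upd eq_sym (negPf xy).
have B1n z : z != x -> B1 z = sB1 s z by rewrite /B1 /upd => /negPf->.
have B1_self z : z \in B1 z.
  by have [->|zx] := eqVneq z x; rewrite ?B1x ?in_ball1 ?eqxx // B1n.
have B1_ball z : B1 z \subset ball1 (sgraph s) z.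
  by have [->|zx] := eqVneq z x; rewrite ?B1x // B1n.
have B2_mono z : sB2 s z \subset B2 z.
  by rewrite /B2 /upd; case: eqP => // ->; apply: subsetUl.
have B2x : B1 y \subset B2 x by rewrite /B2 /upd eqxx subsetUr.
have B12' z : B1 z \subset B2 z.
  have [->|zx] := eqVneq z x; last first.
    by rewrite B1n // (subset_trans (B12 z)).
  rewrite B1x -ball_x subUset sub1set (subsetP B2x) //=.
  exact: subset_trans (B12 x) (B2_mono x).
have B2_ball z : B2 z \subset ball2 (sgraph s) z.
  have [->|zx] := eqVneq z x; last by rewrite /B2 /upd (negPf zx).
  rewrite /B2 /upd eqxx subUset B2s; apply/subsetP => w.
  by move/(subsetP (B1_ball y)); apply: ball2_nbh.
have card_x : #|B1 x| = (sDelta s x + (sdelta s x).+1).+1.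
  by rewrite /B1 /upd eqxx cardsU1 yx card add1n addnS.
have deg_x : #|nbh (sgraph s) x| = (sDelta s x + (sdelta s x).+1)%N.
  by apply: succn_inj; rewrite -card_x B1x card_ball1.
(* Recording [y] makes at most one more vertex of [B1 x] missing, which the increment of [sdelta]
   pays for. *)
have missx a : x \in B1 a -> (#|B1 x :\: B2 a| <= (sdelta s x).+1)%N.
  have [->|ax] := eqVneq a x.
    have /eqP-> : B1 x :\: B2 x == set0 by rewrite setD_eq0.
    by rewrite cards0.
  rewrite B1n // => /miss; rewrite /B1 /upd eqxx => le_d.
  apply: leq_trans (_ : (#|[set y]| + #|sB1 s x :\: sB2 s a| <= _)%N);
    last by rewrite cards1.
  apply: leq_trans (leq_card_setU _ _); apply: subset_leq_card.
  apply/subsetP => z; rewrite !inE => /andP[za].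
  rewrite (contraNN (subsetP (B2_mono a) z)) //=.
have missn a z : z != x -> z \in B1 a -> (#|B1 z :\: B2 a| <= sdelta s z)%N.
  move=> zx; have [->|ax] := eqVneq a x; last first.
    rewrite !B1n // => /miss; apply: leq_trans; apply: subset_leq_card.
    exact: setDS.
  (* The pair [a = x], [z = y] is the only one new to the invariant, and [B2 x] has just absorbed
     [B1 y]. *)
  have [->|zy] := eqVneq z y.
    have /eqP-> : B1 y :\: B2 x == set0 by rewrite setD_eq0.
    by rewrite cards0.
  rewrite /B1 /upd eqxx !inE (negPf zy) (negPf zx) => /miss.
  apply: leq_trans; apply: subset_leq_card; exact: setDS.
have sum_d d : (\sum_z upd (sdelta s) x d z + sdelta s x
                = \sum_z sdelta s z + d)%N.
  rewrite (bigD1 x) //= [in RHS](bigD1 x) //= {1}/upd eqxx.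
  rewrite [X in (_ + X + _)%N](eq_bigr (sdelta s)); first by lia.
  by move=> z /negPf zx; rewrite /upd zx.
rewrite /lazy_endpoint -/B1 -/B2; case: ifP => [le_d|/negbT].
  have D2 z : sub_mem (mem (B2 z))
     (mem (if z \in nbh (sgraph s) x then B2 z :|: B1 x else B2 z)).
    by move=> w wz; case: ifP => // _; rewrite inE wz.
  split=> //=.
  - by move=> z; apply: subset_trans (B12' z) _; apply/subsetP; apply: D2.
  - move=> z; case: ifP => // zx; rewrite subUset B2_ball B1x.
    apply/subsetP => w; apply: ball2_nbh.
    by rewrite inE in zx; rewrite gS.
  - move=> a z za; have [zx|zx] := eqVneq z x.
      suff /eqP-> : B1 z :\:
          (if a \in nbh (sgraph s) x then B2 a :|: B1 x else B2 a) == set0.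
        by rewrite cards0.
      (* If [a] knows [x], then [a] is a neighbor of [x], reached by the propagation, or [x] itself;
         so resetting [sdelta] at [x] to 0 is sound. *)
      rewrite setD_eq0 zx; case: ifP => [_|/negbT]; first exact: subsetUr.
      have /(subsetP (B1_ball a)) := za.
      by rewrite zx in_ball1 inE gS => /orP[/eqP->|->].
    rewrite /upd (negPf zx); apply: leq_trans (missn a z zx za).
    apply: subset_leq_card; apply: setDS; apply/subsetP; exact: D2.
  - move=> z; rewrite /upd; case: eqP => [->|/eqP zx].
      by rewrite addn0.
    by rewrite B1n.
  - move=> z; rewrite /upd; case: eqP => // _.
    by rewrite mulr_ge0 // ltW.
  - move: (sum_d 0%N) cost; rewrite addn0 => <-; rewrite deg_x.
    (* With [d] the new counter, [phi * Delta <= d] means [eps * (Delta + d) <= d]. The potential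
       released is [(d - 1) / eps], so the amortized cost is at most [2 + 1 / eps]. *)
    have : (sDelta s x + (sdelta s x).+1)%:R <= (sdelta s x).+1%:R / eps :> R.
      move: le_d; rewrite ler_pdivlMr // mulrAC ler_pdivrMr ?subr_gt0 // natrD.
      lra.
    rewrite !natrD -!natr1; lra.
rewrite -ltNge => /ltW gt_d.
have ws0 z : (z \in ws) = false by rewrite (tuple0 ws).
split=> //=.
- by move=> z; rewrite ws0.
- by move=> z; rewrite ws0.
- move=> a z za; rewrite ws0 /upd; case: eqP za => [->|/eqP zx] za.
    exact: missx.
  exact: missn.
- move=> z; rewrite /upd; case: eqP => [->|/eqP zx]; first exact: card_x.
  by rewrite B1n.
- by move=> z; rewrite /upd; case: eqP => [->|].
- move: (sum_d (sdelta s x).+1) cost => /(congr1 (fun n => n%:R : R)).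
  rewrite addn0 !natrD -!natr1 => sumE.
  have -> : (\sum_z upd (sdelta s) x (sdelta s x).+1 z)%:R =
      (\sum_z sdelta s z)%:R + 1 :> R by lra.
  lra.
Qed.

(** * Whole insertions and runs *)

Lemma sgraph_insert k (ws : T -> k.-tuple T) u v s :
  sgraph (lazy_insert phi ws u v s) = add_edge (sgraph s) u v.
Proof. by rewrite /lazy_insert !sgraph_endpoint. Qed.

Lemma lazy_init_inv e : 0 < eps < 1 -> simple_graph e -> lazy_inv 0 (lazy_init e).
Proof.
move=> /andP[eps0 eps1] eG; have [eS eI] := eG; split=> //=.
- by move=> x; rewrite in_ball1 eqxx.
- exact: ball1_sub_ball2.
- move=> a x; rewrite in_ball1 => xa.
  suff /eqP-> : ball1 e x :\: ball2 e a == set0 by rewrite cards0.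
  rewrite setD_eq0; case/orP: xa => [/eqP->|ax]; first exact: ball1_sub_ball2.
  by apply/subsetP => z; apply: ball2_nbh.
- by move=> x; rewrite addn0 card_ball1.
- by move=> x; rewrite mulr_ge0 // divr_ge0 ?subr_ge0 // ltW.
- by rewrite big1 // mul0r mul0r addr0.
Qed.

(** The equality of [sB1] with the true balls fails in the middle of an insertion, so it is carried
    alongside the invariant. *)
Lemma lazy_insert_inv k (ws : T -> 0.-tuple T) u v s : 0 < eps < 1 ->
    u != v -> ~~ sgraph s u v ->
    lazy_inv k s -> (forall x, sB1 s x = ball1 (sgraph s) x) ->
  lazy_inv k.+2 (lazy_insert phi ws u v s) /\
  (forall x, sB1 (lazy_insert phi ws u v s) x =
             ball1 (add_edge (sgraph s) u v) x).
Proof.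
move=> eps01 uv nuv [gG self B1s B12 B2s miss card dlt cost] B1E.
have vu : (v == u) = false by rewrite eq_sym (negPf uv).
have sub1 x : ball1 (sgraph s) x \subset ball1 (add_edge (sgraph s) u v) x.
  by rewrite ball1_add_edge subsetUr.
split; last first.
  move=> x; rewrite /lazy_insert !sB1_endpoint /= /upd vu !B1E ball1_add_edge.
  have [->|xv] := eqVneq x v; first by rewrite vu set0U.
  by case: eqP => [->|_]; rewrite ?setU0 ?set0U.
rewrite /lazy_insert; set s0 := State _ _ _ _ _ _.
(* The new edge only enlarges the true balls while the stored data stay fixed, so the upper
   inclusions survive. *)
have inv0 : lazy_inv k s0.
  split=> //=; first exact: add_edge_simple.
    by move=> x; rewrite B1E.
  move=> x; apply: subset_trans (B2s x) _; apply/subsetP => y.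
  rewrite !in_ball2 => /orP[->//|/existsP[z /andP[xz zy]]].
  apply/orP; right; apply/existsP; exists z.
  by rewrite (subsetP (sub1 z)) // andbT /add_edge /= xz.
apply: lazy_endpoint_inv => //; first apply: lazy_endpoint_inv => //=.
- by rewrite B1E in_ball1 vu.
- by rewrite B1E ball1_add_edge eqxx (negPf uv) setU0.
- rewrite sB1_endpoint /upd vu /= B1E in_ball1 (negPf uv) /=.
  by have [gS _] := gG; rewrite gS.
- rewrite sB1_endpoint sgraph_endpoint /upd vu /= B1E ball1_add_edge eqxx vu.
  by rewrite set0U.
Qed.

Lemma lazy_run_inv (ws : nat -> T -> 0.-tuple T) i k s S : 0 < eps < 1 ->
    valid_insertions (sgraph s) S ->
    lazy_inv k s -> (forall x, sB1 s x = ball1 (sgraph s) x) ->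
  let s' := lazy_run phi ws i s S in
  [/\ lazy_inv (k + (size S).*2) s', sgraph s' = insert_edges (sgraph s) S &
      forall x, sB1 s' x = ball1 (sgraph s') x].
Proof.
move=> eps01; elim: S i k s => [|[u v] S IH] i k s /=.
  by move=> _ inv B1E; split; rewrite ?addn0.
case/and3P=> uv nuv val inv B1E.
have [inv' B1E'] := lazy_insert_inv (ws i) eps01 uv nuv inv B1E.
rewrite -(sgraph_insert (ws i)) in val B1E' *.
have [inv'' -> ?] := IH i.+1 _ _ val inv' B1E'.
by split=> //; rewrite doubleS !addnS.
Qed.

Lemma lazy_alg_inv (ws : nat -> T -> 0.-tuple T) e S : 0 < eps < 1 ->
    simple_graph e -> valid_insertions e S ->
  let s := lazy_alg phi ws e S in
  [/\ lazy_inv (size S).*2 s, sgraph s = insert_edges e S &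
      forall x, sB1 s x = ball1 (sgraph s) x].
Proof.
move=> eps01 eG val.
exact: (@lazy_run_inv ws 0 0 (lazy_init e) S eps01 val (lazy_init_inv eps01 eG)).
Qed.

(** * From the invariant to the ratio and the cost *)

Lemma lazy_inv_approx gamma k s v : 0 < eps < 1 ->
    lazy_inv k s -> (forall x, sB1 s x = ball1 (sgraph s) x) ->
    (forall w, w != v ->
      (#|nbh (sgraph s) v :&: ball1 (sgraph s) w| <= gamma.+1)%N) ->
  (1 - eps) / gamma.+1%:R * #|ball2 (sgraph s) v|%:R <= #|sB2 s v|%:R.
Proof.
move=> /andP[eps0 eps1] [[gS gI] self B1s B12 B2s miss card dlt cost] B1E sparse.
apply: ball2_approx => // [|| x vx]; first by rewrite !ltW.
  exact: subsetP (B12 v) _ (self v).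
have /miss : x \in sB1 s v by rewrite B1E in_ball1 vx orbT.
rewrite B1E -(ler_nat R) => /le_trans; apply.
have /succn_inj-> : (deg (sgraph s) x).+1 = (sDelta s x + sdelta s x).+1.
  by rewrite -card B1E card_ball1.
(* The choice of [phi] makes [delta <= phi * Delta] equivalent to
   [delta <= eps * (Delta + delta)]. *)
move: (dlt x); rewrite /phi mulrAC ler_pdivlMr ?subr_gt0 // natrD; lra.
Qed.

End LazyAlg.

Theorem theoremA2 (R : realType) :
  exists C : R, 0 < C /\
  forall (T : finType) (gamma : nat) (eps : R) (e0 : rel T)
         (S : seq (T * T)) (ws : nat -> T -> 0.-tuple T),
    (gamma.+2 <= #|T|)%N ->
    0 < eps < 1 ->
    simple_graph e0 ->
    valid_insertions e0 S ->
    locally_sparse gamma (insert_edges e0 S) ->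
    let phi := eps / (1 - eps) in
    (forall t : nat, (t <= size S)%N -> forall v : T,
       let Bt := sB2 (lazy_alg phi ws e0 (take t S)) v in
       let B := ball2 (insert_edges e0 (take t S)) v in
       Bt \subset B /\
       (1 - eps) / gamma.+1%:R * #|B|%:R <= #|Bt|%:R) /\
    (sunions (lazy_alg phi ws e0 S))%:R <= C / eps * (size S)%:R.
Proof.
(* Each insertion processes two endpoints at amortized cost [2 + 1 / eps <= 3 / eps]. *)
exists 6; split=> // T gamma eps e0 S ws _ eps01 eG val sparse phi.
have [invS gS _] := lazy_alg_inv ws eps01 eG val.
split=> [t _ v Bt B|].
  have [inv g B1E] := lazy_alg_inv ws eps01 eG (valid_take t val).
  split; first by rewrite /B -g; apply: inv_B2 inv v.
  rewrite /B -g; apply: lazy_inv_approx inv B1E _ => // w wv; rewrite g.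
  apply: leq_trans (card_common_mono _ _ (@sub_insert_take T e0 S t)) _.
  apply: locally_sparse_card => //.
  by have [[]] := invS; rewrite gS.
have /andP[eps0 eps1] := eps01.
have := inv_cost invS; set s := lazy_alg _ _ _ _ => cost.
have pot : 0 <= (\sum_x sdelta s x)%:R / eps by rewrite divr_ge0 // ltW.
have inv1 : 1 <= eps^-1 by rewrite invf_ge1 // ltW.
have size0 : 0 <= (size S)%:R * (eps^-1 - 1) by rewrite mulr_ge0 // subr_ge0.
move: cost; rewrite -mul2n natrM; lra.
Qed.
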